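(* The class $\mathcal K_\omega^*$ has the Ramsey property.
   Context: For relational structures $\mathbf A,\mathbf B$ in the same language, $\binom{\mathbf B}{\mathbf A}$ denotes the set of substructures of $\mathbf B$ isomorphic to $\mathbf A$. For $k\ge 1$, $\mathbf C\to(\mathbf B)^{\mathbf A}_k$ means: for every map $c:\binom{\mathbf C}{\mathbf A}\to[k]=\{0,\dots,k-1\}$ there is $\mathbf B'\in\binom{\mathbf C}{\mathbf B}$ such that $c$ is constant on $\binom{\mathbf B'}{\mathbf A}$. A class $\mathcal K$ of finite structures has the Ramsey property if for all $k\ge1$ and all $\mathbf A,\mathbf B\in\mathcal K$ there is $\mathbf C\in\mathcal K$ with $\mathbf C\to(\mathbf B)^{\mathbf A}_k$. A directed graph $(A,E)$ ($E$ irreflexive and asymmetric) is complete multipartite if the relation ''$u=v$, or neither $E(u,v)$ nor $E(v,u)$'' is an equivalence relation on $A$; its classes are called the parts. $\mathcal K_\omega^*$ is the class of finite structures $(A,E,<)$ where $(A,E)$ is a complete multipartite directed graph (with any finite number of parts) and $<$ is a linear order on $A$ for which every part is an interval (a convex linear order). (This is the age of the expansion $\omega*I_\omega^*$ of the generic complete $\omega$-partite directed graph by a convex linear order.) *)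

(* Defs.v *)
From mathcomp Require Import all_boot.
Set Implicit Arguments. Unset Strict Implicit. Unset Printing Implicit Defensive.

(* A finite structure in the language {E, <} is given by a finite carrier
   type T and two binary relations E (edges) and lt (the order). *)

Definition nonadj (T : finType) (E : rel T) : rel T :=
  fun u v => (u == v) || (~~ E u v && ~~ E v u).

Definition digraph (T : finType) (E : rel T) : Prop :=
  irreflexive E /\ (forall u v, E u v -> ~~ E v u).

Definition complete_multipartite (T : finType) (E : rel T) : Prop :=
  digraph E /\ reflexive (nonadj E) /\ symmetric (nonadj E)
  /\ transitive (nonadj E).

Definition linear_order (T : finType) (lt : rel T) : Prop :=
  irreflexive lt /\ transitive lt /\ (forall u v, u != v -> lt u v || lt v u).

Definition convex (T : finType) (E lt : rel T) : Prop :=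
  forall u v w, nonadj E u w -> lt u v -> lt v w -> nonadj E u v.

Definition inK (T : finType) (E lt : rel T) : Prop :=
  complete_multipartite E /\ linear_order lt /\ convex E lt.

Definition embedding (TA TC : finType) (EA ltA : rel TA) (EC ltC : rel TC)
  (f : TA -> TC) : Prop :=
  injective f /\
  (forall x y, EC (f x) (f y) = EA x y) /\
  (forall x y, ltC (f x) (f y) = ltA x y).

Definition is_copy (TA TC : finType) (EA ltA : rel TA) (EC ltC : rel TC)
  (S : {set TC}) : Prop :=
  exists f : TA -> TC, embedding EA ltA EC ltC f /\ S = f @: [set: TA].

(* C -> (B)^A_k ; colourings are maps from subsets of C to [k] (only their
   values on copies of A matter). *)
Definition arrows (k : nat)
  (TA : finType) (EA ltA : rel TA)
  (TB : finType) (EB ltB : rel TB)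
  (TC : finType) (EC ltC : rel TC) : Prop :=
  forall c : {set TC} -> 'I_k,
    exists Bp : {set TC},
      is_copy EB ltB EC ltC Bp /\
      exists i : 'I_k,
        forall S : {set TC}, is_copy EA ltA EC ltC S -> S \subset Bp -> c S = i.

(* Main.v *)
Require Import Defs.
From mathcomp Require Import all_boot zify.
Set Implicit Arguments. Unset Strict Implicit. Unset Printing Implicit Defensive.

(** This is a partite construction over a grid. Place B in the lexicographically
    ordered grid D = [N] x [N], the parts being the columns: a point goes to the
    pair (code of its part, own code), where all codes are taken increasingly
    from [N], the code of a part lying below those of its points and above
    those of all earlier points. A copy of A inside B is then again coded by an
    increasing sequence from [N], so Ramsey's theorem makes a colour constant
    as soon as it depends only on the projection of the copy to D.
    To achieve this dependence, treat the finitely many maps alpha : A -> D in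
    turn. A system over D may carry an arbitrary edge pattern between
    different columns, so only the projection and this pattern must be
    respected. For a system P, the sections of P over alpha that are copies of
    A serve as the alphabet for the Hales-Jewett theorem. Replace the fibres
    over alpha(A) by powers P^N and glue a copy of P along each combinatorial
    line; a monochromatic line yields a copy of P on which all sections over
    alpha have the same colour. *)

(** * The Hales-Jewett theorem by colour focusing *)

Section HalesJewett.
Variable S : finType.
Implicit Types (A : seq S) (w : seq (option S)).

Definition subst w (s : S) : seq S := [seq odflt s o | o <- w].

Lemma subst_cat w1 w2 s : subst (w1 ++ w2) s = subst w1 s ++ subst w2 s.
Proof. exact: map_cat. Qed.

Lemma subst_const (u : seq S) s : subst [seq Some x | x <- u] s = u.
Proof. by rewrite /subst -map_comp map_id_in. Qed.

Definition mono_on (K : Type) (c : seq S -> K) A w :=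
  forall s s', s \in A -> s' \in A -> c (subst w s) = c (subst w s').

(** Restricting to letters in [A] allows induction with [S] fixed; [K] varies because prefixes get
    coloured by functions on suffixes. *)
Definition hales_jewett_on A := forall K : finType, exists N, forall c : seq S -> K,
  exists w, [/\ size w = N, None \in w & mono_on c A w].

(* The [ws] are lines focused at [f]: they all take the letter [x] to [f], and
   their colours on [A] are pairwise distinct. *)
Lemma color_focusing A a x (K : finType) r : hales_jewett_on A -> a \in A ->
  exists N, forall c : seq S -> K,
    (exists w, [/\ size w = N, None \in w & mono_on c (x :: A) w]) \/
    (exists (f : seq S) (ws : seq (seq (option S))),
      [/\ size f = N, size ws = r, uniq [seq c (subst w a) | w <- ws] &
        forall w, w \in ws ->
          [/\ size w = N, None \in w, subst w x = f & mono_on c A w]]).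
Proof.
move=> HJ aA; elim: r => [|r [N IH]].
  by exists 0 => c; right; exists [::], [::]; split.
have [M HM] := HJ {ffun N.-tuple S -> K}; exists (M + N) => c.
have [w [szw Nw mw]] := HM (fun u => [ffun v : N.-tuple S => c (u ++ v)]).
have {}mw s s' v : s \in A -> s' \in A -> size v = N ->
    c (subst w s ++ v) = c (subst w s' ++ v).
  move=> sA s'A /eqP szv; have /ffunP/(_ (Tuple szv)) := mw _ _ sA s'A.
  by rewrite !ffunE.
pose u := [seq Some y | y <- subst w a].
have szu : size u = M by rewrite !size_map.
case: (IH (fun v => c (subst w a ++ v))) => [[v [szv Nv mv]]|].
  left; exists (u ++ v); split; first by rewrite size_cat szu szv.
    by rewrite mem_cat Nv orbT.
  by move=> s s' sA s'A; rewrite !subst_cat !subst_const; apply: mv.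
move=> [f [ws [szf szws uws Hws]]].
(* If the focus repeats the colour of a line [v], that line is monochromatic on [x] too; otherwise
   [w] followed by the constant [f] brings a new colour. *)
have [/mapP[v vws cfv]|fresh] := boolP (c (subst w a ++ f) \in
    [seq c (subst w a ++ subst v a) | v <- ws]).
  have [szv Nv vx mv] := Hws _ vws.
  left; exists (u ++ v); split; first by rewrite size_cat szu szv.
    by rewrite mem_cat Nv orbT.
  suff H s : s \in x :: A -> c (subst (u ++ v) s) = c (subst w a ++ f).
    by move=> s s' sA s'A; rewrite !H.
  rewrite subst_cat subst_const inE => /predU1P[->|sA]; first by rewrite vx.
  by rewrite cfv; apply: mv.
right; exists (subst w x ++ f).
exists ((w ++ [seq Some y | y <- f]) :: [seq w ++ v | v <- ws]).
split.
- by rewrite size_cat size_map szf szw.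
- by rewrite /= size_map szws.
- rewrite /= -map_comp subst_cat subst_const.
  have -> : [seq ((fun w => c (subst w a)) \o cat w) i | i <- ws] =
            [seq c (subst w a ++ subst v a) | v <- ws].
    by apply: eq_map => v /=; rewrite subst_cat.
  by rewrite fresh.
- move=> v; rewrite inE => /predU1P[->|/mapP[v' /Hws[szv Nv vx mv] ->]].
    split; first by rewrite size_cat size_map szf szw.
    + by rewrite mem_cat Nw.
    + by rewrite subst_cat subst_const.
    + by move=> s s' sA s'A; rewrite !subst_cat !subst_const; apply: mw.
  split; first by rewrite size_cat szv szw.
  + by rewrite mem_cat Nw.
  + by rewrite subst_cat vx.
  + move=> s s' sA s'A; rewrite !subst_cat.
    rewrite (mw s a) ?(mw s' a) ?size_map //; exact: mv.
Qed.

(** More focused lines than colours cannot have distinct colours, which leaves the first alternative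
    of [color_focusing]. *)
Lemma hales_jewett_seq A : hales_jewett_on A.
Proof.
elim: A => [|x [|a A] HJ] K.
- by exists 1 => c; exists [:: None]; split.
- exists 1 => c; exists [:: None]; split=> // s s'.
  by rewrite !inE => /eqP-> /eqP->.
have [N HN] := color_focusing x K #|K|.+1 HJ (mem_head a A).
exists N => c; case: (HN c) => // -[f [ws [_ szws uws _]]].
by have := max_card [in [seq c (subst w a) | w <- ws]];
  rewrite (card_uniqP uws) size_map szws ltnn.
Qed.

Lemma hales_jewett (K : finType) : exists N, forall c : N.-tuple S -> K,
  exists w : N.-tuple (option S), None \in w /\
    forall s s', c (map_tuple (odflt s) w) = c (map_tuple (odflt s') w).
Proof.
have [N HN] := hales_jewett_seq (enum S) (option K); exists N => c.
have [w [/eqP szw Nw mw]] := HN (fun u => omap c (insub u)).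
exists (Tuple szw); split=> // s s'.
have := mw s s' (mem_enum _ _) (mem_enum _ _).
have E x : subst w x = map_tuple (odflt x) (Tuple szw) by [].
by rewrite !E !valK /= => -[].
Qed.

End HalesJewett.

(** * Ramsey's theorem for increasing sequences *)

Section Ramsey.
Variable K : finType.

Definition homogeneous (p : nat) (c : seq nat -> K) (H : seq nat) :=
  exists i, forall s, subseq s H -> size s = p -> c s = i.

Lemma ramsey_subseq (i0 : K) p m : exists M, forall (c : seq nat -> K) L,
  uniq L -> M <= size L -> exists H, [/\ subseq H L, size H = m & homogeneous p c H].
Proof.
elim: p m => [|p IHp] m.
  exists m => c L uL szL; exists (take m L); split; first exact: take_subseq.
    by rewrite size_takel.
  by exists (c [::]) => s _ /size0nil->.
(* End-homogeneity: the colour of a subsequence depends only on its head. *)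
have endhom n : exists M, forall (c : seq nat -> K) L, uniq L -> M <= size L ->
    exists H (i : nat -> K), [/\ subseq H L, size H = n &
      forall x s, subseq (x :: s) H -> size s = p -> c (x :: s) = i x].
  elim: n => [|n [M IHn]].
    by exists 0 => c L _ _; exists [::], (fun=> i0); split=> //; rewrite sub0seq.
  (* The tail is made homogeneous for the colouring of [s] by [c (x :: s)], then thinned by
     induction. *)
  have [M' HM'] := IHp M; exists M'.+1 => c [|x L] //= /andP[xL uL] szL.
  have [H' [sub' szH' [i Hi]]] := HM' (fun s => c (x :: s)) L uL szL.
  have [|H [j [sub szH Hj]]] := IHn c H' (subseq_uniq sub' uL); first by rewrite szH'.
  have xH : x \notin H.
    by apply: contra xL; apply: mem_subseq; apply: subseq_trans sub'.
  exists (x :: H), (fun y => if y == x then i else j y); split=> /=.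
  - by rewrite eqxx; apply: subseq_trans sub'.
  - by rewrite szH.
  move=> y s; case: eqP => [-> sH szs|_ sH szs]; last exact: Hj.
  by apply: Hi => //; apply: subseq_trans sub.
have [M HM] := endhom (#|K| * m); exists M => c L uL szL.
have [H [i [sub szH Hi]]] := HM c L uL szL.
have [j Hj] : exists j, m <= count (fun x => i x == j) H.
  apply/existsP; rewrite -[[exists _, _]]negbK negb_exists; apply/negP => /forallP lt_m.
  have : \sum_(j : K) count (fun x => i x == j) H = size H.
    elim: (H) => [|x s IHs] /=; first by rewrite big1.
    rewrite big_split /= IHs (bigD1 (i x)) //= eqxx big1 // => j /negPf.
    by rewrite eq_sym => ->.
  have m_gt0 : 0 < m by have := lt_m i0; rewrite -ltnNge; case: (m).
  have : \sum_(j : K) count (fun x => i x == j) H <= \sum_(j : K) m.-1.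
    by apply: leq_sum => j _; have := lt_m j; lia.
  rewrite sum_nat_const szH => le1 eq1; have K_gt0 : 0 < #|K| by apply/card_gt0P; exists i0.
  by move: le1; rewrite eq1 leq_pmul2l //; lia.
pose F := [seq x <- H | i x == j].
exists (take m F); split.
- apply: subseq_trans (take_subseq _ _) _.
  by apply: subseq_trans sub; apply: filter_subseq.
- by rewrite size_takel // size_filter.
exists j => -[|x s] // sF [szs].
have {}sF := subseq_trans sF (take_subseq _ _).
rewrite (Hi x s) //; last by apply: subseq_trans sF (filter_subseq _ _).
by have := mem_subseq sF (mem_head x s); rewrite mem_filter => /andP[/eqP].
Qed.

Lemma ramsey (i0 : K) p q : exists N, forall c : seq nat -> K,
  exists h : nat -> nat,
    [/\ forall i j, i < j < q -> h i < h j, forall i, i < q -> h i < N &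
      exists i0, forall phi : nat -> nat,
        (forall i j, i < j < p -> phi i < phi j) ->
        (forall i, i < p -> phi i < q) -> c (mkseq (h \o phi) p) = i0].
Proof.
have [N HN] := ramsey_subseq i0 p q; exists N => c.
have [|H [sub szH [i Hi]]] := HN c (iota 0 N) (iota_uniq _ _).
  by rewrite size_iota.
have sH : sorted ltn H.
  by apply: subseq_sorted sub (iota_ltn_sorted _ _); apply: ltn_trans.
have h_lt j k : j < k < q -> nth 0 H j < nth 0 H k.
  move=> /andP[jk kq]; apply: (sorted_ltn_nth ltn_trans 0 sH) => //; rewrite inE szH //.
  exact: ltn_trans kq.
exists (nth 0 H); split=> //.
  move=> j jq; have /(mem_subseq sub) : nth 0 H j \in H by rewrite mem_nth ?szH.
  by rewrite mem_iota.
exists i => phi phi_lt phi_q; apply: Hi; last by rewrite size_mkseq.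
set t := mkseq _ _.
have -> : t = [seq x <- H | x \in t].
  apply: (irr_sorted_eq ltn_trans ltnn).
  - apply/(sortedP 0) => j; rewrite size_mkseq => jp.
    rewrite !nth_mkseq //=; last exact: ltnW.
    by apply: h_lt; rewrite phi_lt ?leqnn ?phi_q.
  - exact: sorted_filter ltn_trans _ _ sH.
  - move=> x; rewrite mem_filter andb_idr // => /mapP[j].
    by rewrite mem_iota => /phi_q jq ->; rewrite mem_nth ?szH.
exact: filter_subseq.
Qed.

End Ramsey.

(** * Systems over [D] and the partite construction *)

Section Partite.
Variables (D : finType) (adj : rel D) (TA : finType) (EA : rel TA).

(* [edge] is only meaningful on pairs with [adj]-related projections. *)
Record system := System {
  vertex :> finType; proj : vertex -> D; edge : rel vertex }.

Definition morphism (P Q : system) (phi : P -> Q) :=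
  (forall p, proj (phi p) = proj p) /\
  (forall p q, adj (proj p) (proj q) -> edge (phi p) (phi q) = edge p q).

(** With [alpha] injective, [a] can be recovered from the projection of [s a]. *)
Definition section_over (P : system) (alpha : {ffun TA -> D}) (s : {ffun TA -> P}) :=
  [&& injectiveb alpha, [forall a, proj (s a) == alpha a] &
      [forall a, forall b, adj (alpha a) (alpha b) ==> (edge (s a) (s b) == EA a b)]].

Lemma section_overP (P : system) (alpha : {ffun TA -> D}) (s : {ffun TA -> P}) :
  reflect [/\ injective alpha, forall a, proj (s a) = alpha a &
            forall a b, adj (alpha a) (alpha b) -> edge (s a) (s b) = EA a b]
    (section_over alpha s).
Proof.
apply: (iffP and3P) => -[H1 H2 H3]; split.
- exact/injectiveP.
- by move=> a; apply/eqP/(forallP H2).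
- by move=> a b /(implyP (forallP (forallP H3 a) b))/eqP.
- exact/injectiveP.
- by apply/forallP=> a; apply/eqP.
- by apply/forallP=> a; apply/forallP=> b; apply/implyP=> /H3/eqP.
Qed.

Lemma section_over_morphism (P Q : system) (phi : P -> Q)
    (alpha : {ffun TA -> D}) (s : {ffun TA -> P}) :
  morphism phi -> section_over alpha s -> section_over alpha [ffun a => phi (s a)].
Proof.
move=> [pphi ephi] /section_overP[H1 H2 H3]; apply/section_overP; split=> //.
  by move=> a; rewrite ffunE pphi.
by move=> a b ab; rewrite !ffunE ephi ?H2 // H3.
Qed.

Section Step.
Variables (alpha : {ffun TA -> D}) (P : system) (N : nat).

Definition sections := {s : {ffun TA -> P} | section_over alpha s}.
Definition point (s : sections) : TA -> P := val s.
(** Points [inl (a, u)] over [alpha a] are shared by all lines; [inr (w, p)] belongs to the copy of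
    [P] along [w] alone. *)
Definition power : finType := (TA * N.-tuple P + N.-tuple (option sections) * P)%type.

Definition power_proj (x : power) : D :=
  match x with inl (a, _) => alpha a | inr (_, p) => proj p end.

(* Between two power fibres the edge agrees with A iff it does so in every
   coordinate. A line [w] takes [p] to a tuple having [p] at each wildcard
   ([None]), so reading a wildcard position of [w] recovers [p]. *)
Definition power_edge (x y : power) : bool :=
  match x, y with
  | inl (a, u), inl (b, v) => all2 (fun p q => edge p q == EA a b) u v == EA a b
  | inl (_, u), inr (w, p) => edge (nth p u (index None w)) p
  | inr (w, p), inl (_, v) => edge p (nth p v (index None w))
  | inr (_, p), inr (_, q) => edge p q
  end.

Definition power_system := @System power power_proj power_edge.

Definition on_line (w : N.-tuple (option sections)) (p : P) : power_system :=
  if [pick a | alpha a == proj p] is Some a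
  then inl (a, map_tuple (fun o => if o is Some s then point s a else p) w)
  else inr (w, p).

(** Between two powers, coordinates at a fixed letter agree with [EA], since they come from a
    section. The wildcards, which all carry the pair [p], [q], thus decide the edge. *)
Lemma on_line_morphism w : None \in w -> morphism (on_line w).
Proof.
move=> Nw.
have nthw (F : option sections -> P) p : nth p (map F w) (index None w) = F None.
  by rewrite (nth_map None) ?index_mem // nth_index.
split=> [p|p q pq]; rewrite /on_line; first by case: pickP => //= a /eqP.
case: pickP => [a /eqP ea|_]; case: pickP => [b /eqP eb|_] //=; rewrite ?nthw //.
have -> : all2 (fun p q => edge p q == EA a b)
    [seq (if o is Some s then point s a else p) | o <- w]
    [seq (if o is Some s then point s b else q) | o <- w] = (edge p q == EA a b).
  apply/idP/idP => [|pqE].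
    move: (Nw : None \in tval w) => /[swap]; elim: (tval w) => [|o s IHs] //=.
    move=> /andP[H1 H2].
    by rewrite inE => /predU1P[e|/(IHs H2)//]; rewrite -e in H1.
  elim: (tval w) => [|[s|] l IHl] //=; rewrite IHl; last by rewrite pqE.
  rewrite andbT /point; have /section_overP[_ _ ->] := svalP s; first exact: eqxx.
  by rewrite ea eb.
by case: (edge p q); case: (EA a b).
Qed.

End Step.

(** A word of sections is read coordinatewise as a set of points in the powers; substituting [t] in
    a line [w] gives the image of [t] under [on_line w]. *)
Lemma partite_lemma (alpha : {ffun TA -> D}) (P : system) (K : finType) :
  exists Q : system, forall c : {set Q} -> K,
    exists phi : P -> Q, morphism phi /\
      forall s s' : {ffun TA -> P}, section_over alpha s -> section_over alpha s' ->
        c [set phi (s a) | a in TA] = c [set phi (s' a) | a in TA].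
Proof.
have [N HN] := hales_jewett (sections alpha P) K.
exists (power_system alpha P N) => c.
have [w [Nw mw]] := HN (fun u : N.-tuple (sections alpha P) =>
  c [set (inl (a, map_tuple (fun s => point s a) u) : power alpha P N) | a in TA]).
exists (on_line w); split; first exact: on_line_morphism.
move=> s s' Hs Hs'.
suff E (t : sections alpha P) : [set on_line w (point t a) | a in TA] =
   [set (inl (a, map_tuple (fun s => point s a) (map_tuple (odflt t) w))
        : power alpha P N) | a in TA].
  have := mw (exist _ s Hs) (exist _ s' Hs').
  by rewrite -!E.
apply: eq_imset => a; rewrite /on_line.
have /section_overP[inj pt _] := svalP t.
case: pickP => [b|/(_ a)]; rewrite pt ?eqxx // => /eqP/inj->.
congr (inl (_, _)); apply: val_inj; rewrite /= -map_comp; apply: eq_map.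
by case.
Qed.

(** Homogeneity for [l], obtained first, persists on the copy chosen for [alpha], since morphisms
    preserve sections over each map. *)
Lemma partite_construction (l : seq {ffun TA -> D}) (P : system) (K : finType) :
  exists Q : system, forall c : {set Q} -> K,
    exists phi : P -> Q, morphism phi /\
      forall (alpha : {ffun TA -> D}) (s s' : {ffun TA -> P}), alpha \in l ->
        section_over alpha s -> section_over alpha s' ->
        c [set phi (s a) | a in TA] = c [set phi (s' a) | a in TA].
Proof.
elim: l P => [|alpha l IHl] P.
  by exists P => c; exists id.
have [Q HQ] := partite_lemma alpha P K; have [R HR] := IHl Q.
exists R => c; have [psi [mpsi Hpsi]] := HR c.
have [phi [mphi Hphi]] := HQ (fun X => c [set psi x | x in X]).
exists (psi \o phi); split.
  split=> [p|p q pq] /=; first by rewrite mpsi.1 mphi.1.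
  by rewrite mpsi.2 ?mphi.1 ?mphi.2.
move=> beta s s'; rewrite inE => /predU1P[->|bl] Hs Hs'.
  by have := Hphi s s' Hs Hs'; rewrite -!imset_comp.
have := Hpsi _ _ _ bl (section_over_morphism mphi Hs) (section_over_morphism mphi Hs').
by congr (c _ = c _); apply: eq_imset => a; rewrite ffunE.
Qed.

End Partite.

(** * Ranks of points and of parts *)

Section Ranks.
Variables (T : finType) (E lt : rel T).
Hypothesis KT : inK E lt.

Definition rank (a : T) := #|[pred b | lt b a]|.
(* By convexity, this is the rank of the least element of the part of [a]. *)
Definition part_rank (a : T) := #|[pred b | lt b a && ~~ nonadj E b a]|.

Lemma nonadj_refl : reflexive (nonadj E). Proof. by case: KT => -[_ []]. Qed.
Lemma nonadj_sym : symmetric (nonadj E). Proof. by case: KT => -[_ [_ []]]. Qed.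
Lemma nonadj_trans : transitive (nonadj E). Proof. by case: KT => -[_ [_ []]]. Qed.
Lemma lt_irr a : lt a a = false. Proof. by case: KT => _ [[->]]. Qed.
Lemma lt_tr : transitive lt. Proof. by case: KT => _ [[_ []]]. Qed.
Lemma lt_total a b : [\/ a = b, lt a b | lt b a].
Proof.
case: KT => _ [[_ [_ tot]] _]; have [->|/tot/orP[]] := eqVneq a b.
- by constructor 1. - by constructor 2. - by constructor 3.
Qed.
Lemma lt_convex : convex E lt. Proof. by case: KT => _ []. Qed.

Lemma edge_nonadj a b : nonadj E a b -> E a b = false.
Proof.
by case: KT => -[[irr _] _] _ /orP[/eqP->|/andP[/negPf]]; first exact: irr.
Qed.

Lemma edge_flip a b : ~~ nonadj E a b -> E b a = ~~ E a b.
Proof.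
case: KT => -[[_ asym] _] _; rewrite negb_or negb_and !negbK => /andP[_].
by have := asym a b; case: (E a b) => [/(_ isT)/negPf|].
Qed.

Lemma rank_lt a b : lt a b -> rank a < rank b.
Proof.
move=> ab; apply: proper_card; apply/properP; split.
  by apply/subsetP => c; rewrite !inE => /lt_tr; apply.
by exists a; rewrite !inE ?lt_irr.
Qed.

Lemma ltE a b : lt a b = (rank a < rank b).
Proof.
apply/idP/idP => [|r_ab]; first exact: rank_lt.
by case: (lt_total a b) => [e|//|/rank_lt]; first rewrite e in r_ab; lia.
Qed.

Lemma rank_inj : injective rank.
Proof. by move=> a b e; case: (lt_total a b) => // /rank_lt; rewrite e ltnn. Qed.

Lemma rank_bound a : rank a < #|T|.
Proof.
apply: proper_card; apply/properP; split; first exact/subsetP.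
by exists a; rewrite ?inE ?lt_irr.
Qed.

Lemma rank_surj i : i < #|T| -> exists a, rank a = i.
Proof.
move=> iT; pose f a : 'I_#|T| := Ordinal (rank_bound a).
have f_inj : injective f by move=> a b /(congr1 val)/rank_inj.
have [g _ gK] := inj_card_bij f_inj (eq_leq (card_ord _)).
by exists (g (Ordinal iT)); have /(congr1 val) := gK (Ordinal iT).
Qed.

Lemma part_rank_le a : part_rank a <= rank a.
Proof. by apply: subset_leq_card; apply/subsetP => b; rewrite !inE => /andP[]. Qed.

Lemma part_rank_nonadj a b : nonadj E a b -> part_rank a = part_rank b.
Proof.
suff H x y c : nonadj E x y -> lt c x && ~~ nonadj E c x -> lt c y && ~~ nonadj E c y.
  move=> ab; apply: eq_card => c; rewrite !inE; apply/idP/idP; first exact: H.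
  by apply: H; rewrite nonadj_sym.
move=> xy /andP[cx ncx].
have ncy : ~~ nonadj E c y.
  by apply: contra ncx => cy; apply: nonadj_trans cy _; rewrite nonadj_sym.
rewrite ncy andbT; case: (lt_total c y) => [e|//|yc].
  by rewrite e nonadj_refl in ncy.
by rewrite nonadj_sym (lt_convex _ yc cx) // nonadj_sym in ncy.
Qed.

(** By convexity no point below [a] is in the part of [b]; [a] itself is counted only on the
    right. *)
Lemma rank_part_rank a b : lt a b -> ~~ nonadj E a b -> rank a < part_rank b.
Proof.
move=> ab nab; apply: proper_card; apply/properP; split; last first.
  by exists a; rewrite !inE ?lt_irr // ab.
apply/subsetP => c; rewrite !inE => ca; rewrite (lt_tr ca ab) /=.
apply: contra nab => cb; apply: (nonadj_trans _ cb).
by rewrite nonadj_sym (lt_convex cb ca ab).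
Qed.

Lemma nonadjE a b : nonadj E a b = (part_rank a == part_rank b).
Proof.
apply/idP/eqP => [|e]; first exact: part_rank_nonadj.
apply/negPn/negP => nab; case: (lt_total a b) => [ab|ab|ba].
- by rewrite ab nonadj_refl in nab.
- by have := rank_part_rank ab nab; have := part_rank_le a; lia.
- rewrite nonadj_sym in nab.
  by have := rank_part_rank ba nab; have := part_rank_le b; lia.
Qed.

Lemma part_rank_rank a : exists b, rank b = part_rank a /\ nonadj E b a.
Proof.
have [b rb] := rank_surj (leq_ltn_trans (part_rank_le a) (rank_bound a)).
exists b; split=> //; apply/negPn/negP => nba.
case: (lt_total b a) => [e|ba|/rank_lt].
- by rewrite e nonadj_refl in nba.
- by have := rank_part_rank ba nba; rewrite rb ltnn.
- by have := part_rank_le a; lia.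
Qed.

Lemma part_rank_lt a b : (part_rank a < part_rank b) = lt a b && ~~ nonadj E a b.
Proof.
apply/idP/andP => [lt_ab|[ab nab]].
  rewrite nonadjE; split; last lia.
  case: (lt_total a b) => [e|//|ba]; first by rewrite e ltnn in lt_ab.
  have nba : ~~ nonadj E b a by rewrite nonadjE; lia.
  by have := rank_part_rank ba nba; have := part_rank_le b; lia.
by apply: leq_ltn_trans (rank_part_rank ab nab); apply: part_rank_le.
Qed.

Lemma part_rank_mono a b : rank a <= rank b -> part_rank a <= part_rank b.
Proof.
by move=> ab; rewrite leqNgt part_rank_lt ltE; apply/negP => /andP[]; lia.
Qed.

End Ranks.

(** * Increasing codes of a substructure *)

Section Substructure.
Variables (TA : finType) (EA ltA : rel TA) (TB : finType) (EB ltB : rel TB).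
Hypotheses (KA : inK EA ltA) (KB : inK EB ltB).
Variables (f : TA -> TB) (emb : embedding EA ltA EB ltB f).

Lemma embedding_nonadj a b : nonadj EB (f a) (f b) = nonadj EA a b.
Proof. by case: emb => inj [eE _]; rewrite /nonadj !eE (inj_eq inj). Qed.

(* B uses position [2 * part_rank] for the code of a part and [2 * rank + 1] for
   that of a point. An even position of A that belongs to no part is sent to
   the position just below its point, which keeps the map increasing. *)
Definition slot (e : nat -> TA) (j : nat) : nat :=
  let a := e j./2 in
  if odd j then (rank ltB (f a)).*2.+1
  else (if part_rank EA ltA a == rank ltA a then part_rank EB ltB (f a)
        else rank ltB (f a)).*2.

(** Makes a copy of A in B an increasing selection of codes of B, the form that Ramsey's theorem
    handles. *)
Lemma slots : exists phi : nat -> nat,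
  [/\ forall i j, i < j < #|TA|.*2 -> phi i < phi j,
      forall i, i < #|TA|.*2 -> phi i < #|TB|.*2,
      forall a, phi (part_rank EA ltA a).*2 = (part_rank EB ltB (f a)).*2 &
      forall a, phi (rank ltA a).*2.+1 = (rank ltB (f a)).*2.+1].
Proof.
case: (posnP #|TA|) => [TA0|TA_gt0].
  have no (a : TA) : False by have := card0_eq TA0 a; rewrite inE.
  by exists id; rewrite TA0; split=> [i j|i|a|a]; [lia | lia | case: (no a) | case: (no a)].
have [a0 _] := rank_surj KA TA_gt0.
pose e i := odflt a0 [pick a | rank ltA a == i].
have rK a : e (rank ltA a) = a.
  rewrite /e; case: pickP => [b /eqP/(rank_inj KA)|/(_ a)] //=.
  by rewrite eqxx.
have eK i : i < #|TA| -> rank ltA (e i) = i.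
  by move=> /(rank_surj KA)[a <-]; rewrite rK.
have part_f a : part_rank EB ltB (f a) <= rank ltB (f a) := part_rank_le _ _ _.
have rank_f a b : rank ltA a < rank ltA b -> rank ltB (f a) < rank ltB (f b).
  by rewrite -(ltE KA) -(ltE KB); case: emb => _ [_ ->].
exists (slot e); split.
- suff step j : j.+1 < #|TA|.*2 -> slot e j < slot e j.+1.
    move=> i j /andP[ij jT]; elim: j ij jT => // j IHj; rewrite ltnS leq_eqVlt.
    move=> /predU1P[-> | ij] jT; first exact: step.
    by apply: ltn_trans (IHj ij _) (step _ jT); lia.
  move=> jT; rewrite /slot /= uphalfE /=.
  have [odd_j|even_j] := boolP (odd j) => /=; last first.
    have -> : uphalf j = j./2 by lia.
    by have := part_f (e j./2); case: ifP; lia.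
  have -> : uphalf j = j./2.+1 by lia.
  have r1 : rank ltA (e j./2) = j./2 by apply: eK; lia.
  have r2 : rank ltA (e j./2.+1) = j./2.+1 by apply: eK; lia.
  have lt12 : rank ltA (e j./2) < rank ltA (e j./2.+1) by lia.
  (* If the next point leads its part, the next position codes that part, and the current point lies
     in an earlier one. *)
  have := rank_f _ _ lt12; case: eqP => [lead _|_]; last lia.
  suff : rank ltB (f (e j./2)) < part_rank EB ltB (f (e j./2.+1)) by lia.
  apply: (rank_part_rank KB); first by rewrite (ltE KB) rank_f.
  rewrite embedding_nonadj (nonadjE KA); have := part_rank_le EA ltA (e j./2); lia.
- move=> j jT; rewrite /slot.
  have := rank_bound KB (f (e j./2)); have := part_f (e j./2).
  by case: (odd j) => /=; [|case: ifP => _]; lia.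
- move=> a; have [b [rb ba]] := part_rank_rank KA a.
  rewrite /slot odd_double doubleK -rb rK (part_rank_nonadj KA ba) -rb eqxx.
  by congr (_.*2); apply: (part_rank_nonadj KB); rewrite embedding_nonadj.
- by move=> a; rewrite /slot /= odd_double /= uphalf_double rK.
Qed.

End Substructure.

(** * Structures of the class built from systems over a grid *)

Section Grid.
Variable N : nat.
Let D : finType := ('I_N.+1 * 'I_N.+1)%type.
Definition grid_adj : rel D := fun d e => d.1 < e.1.

Definition decode (T : finType) (E lt : rel T) (h : nat -> nat) : {ffun T -> D} :=
  [ffun a => (inord (h (part_rank E lt a).*2), inord (h (rank lt a).*2.+1))].

Section System.
Variable P : system D.
(** The tie-break by [enum_rank] is arbitrary: maps as in [decode_embedding] meet each fibre at most
    once. *)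
Definition sys_lt : rel P := fun x y =>
  let: (dx, dy) := (proj x, proj y) in
  (dx.1 < dy.1) || (dx.1 == dy.1 :> nat) &&
    ((dx.2 < dy.2) || (dx.2 == dy.2 :> nat) && (enum_rank x < enum_rank y)).
(** Reading [edge] from left to right only, and negating it backwards, turns any pattern into a
    complete multipartite digraph. *)
Definition sys_edge : rel P := fun x y =>
  if (proj x).1 < (proj y).1 then edge x y
  else if (proj y).1 < (proj x).1 then ~~ edge y x else false.

Lemma sys_nonadj x y : nonadj sys_edge x y = ((proj x).1 == (proj y).1 :> nat).
Proof.
rewrite /nonadj /sys_edge; have [->|_] := eqVneq x y; first by rewrite eqxx.
by case: ltngtP => //= _; case: (edge _ _).
Qed.

Lemma sys_inK : inK sys_edge sys_lt.
Proof.
split; [split; [split|split; [|split]]|split; [split; [|split]|]].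
- by move=> x; rewrite /sys_edge ltnn.
- by move=> x y; rewrite /sys_edge; case: ltngtP => // _; case: edge.
- by move=> x; rewrite sys_nonadj.
- by move=> x y; rewrite !sys_nonadj eq_sym.
- by move=> x y z; rewrite !sys_nonadj => /eqP-> /eqP->.
- by move=> x; rewrite /sys_lt !ltnn !andbF.
- by move=> y x z; rewrite /sys_lt; lia.
- move=> x y; have : x != y -> enum_rank x != enum_rank y :> nat.
    by apply: contra => /eqP/val_inj/enum_rank_inj->.
  by rewrite /sys_lt => H /H; lia.
- by move=> x y z; rewrite !sys_nonadj /sys_lt; lia.
Qed.
End System.

(** As [h] is increasing, columns compare as parts and second coordinates as points; [part_rank]
    being monotone in [rank], the lexicographic order restricts to [lt]. *)
Lemma decode_embedding (P : system D) (T : finType) (E lt : rel T) (h : nat -> nat)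
    (f : T -> P) :
  inK E lt ->
  (forall i j, i < j < #|T|.*2 -> h i < h j) ->
  (forall i, i < #|T|.*2 -> h i < N) ->
  (forall a, proj (f a) = decode E lt h a) ->
  (forall a b, grid_adj (proj (f a)) (proj (f b)) -> edge (f a) (f b) = E a b) ->
  embedding E lt (@sys_edge P) (@sys_lt P) f.
Proof.
move=> KT h_lt hN pf ef.
have rb a : rank lt a < #|T| := rank_bound KT a.
have pb a : part_rank E lt a <= rank lt a := part_rank_le _ _ _.
have p1 a : (proj (f a)).1 = h (part_rank E lt a).*2 :> nat.
  rewrite pf ffunE inordK // ltnS ltnW // hN //.
  by have := rb a; have := pb a; lia.
have p2 a : (proj (f a)).2 = h (rank lt a).*2.+1 :> nat.
  by rewrite pf ffunE inordK // ltnS ltnW // hN //; have := rb a; lia.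
have h_mono i j : i < #|T|.*2 -> j < #|T|.*2 -> (h i < h j) = (i < j).
  move=> iT jT; case: (ltngtP i j) => [ij|ji|->]; last exact: ltnn.
  - by rewrite h_lt ?ij.
  - by have := h_lt j i; rewrite ji iT => /(_ isT); lia.
have lt1 a b : ((proj (f a)).1 < (proj (f b)).1) = (part_rank E lt a < part_rank E lt b).
  by rewrite !p1 h_mono ?ltn_double //; move: (rb a) (rb b) (pb a) (pb b); lia.
have lt2 a b : ((proj (f a)).2 < (proj (f b)).2) = (rank lt a < rank lt b).
  by rewrite !p2 h_mono ?ltnS ?ltn_double //; move: (rb a) (rb b); lia.
have lt_f a b : sys_lt (f a) (f b) = lt a b.
  have [->|ab] := eqVneq a b; first by rewrite (lt_irr (sys_inK P)) (lt_irr KT).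
  have r : rank lt a != rank lt b by apply: contra ab => /eqP/(rank_inj KT)->.
  rewrite /sys_lt (ltE KT); move: (lt1 a b) (lt1 b a) (lt2 a b) (lt2 b a).
  move: (@part_rank_mono _ _ _ KT a b) (@part_rank_mono _ _ _ KT b a).
  case: (ltngtP (rank lt a) (rank lt b)) r => // r _.
    by move=> /(_ isT) m _; lia.
  by move=> _ /(_ isT) m; lia.
split; [|split] => [a b e|a b|//].
  by case: (lt_total KT a b) => //; rewrite -lt_f e ?lt_irr //; rewrite (lt_irr (sys_inK P)).
rewrite /sys_edge; case: ifP => [ab|ab]; first exact: ef.
case: ifP => [ba|ba].
  rewrite ef // (edge_flip KT) ?negbK // (nonadjE KT).
  by move: ba; rewrite lt1; lia.
by rewrite (edge_nonadj KT) // (nonadjE KT); move: ab ba; rewrite !lt1; lia.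
Qed.

Lemma decode_inj (T : finType) (E lt : rel T) (h : nat -> nat) :
  inK E lt ->
  (forall i j, i < j < #|T|.*2 -> h i < h j) ->
  (forall i, i < #|T|.*2 -> h i < N) ->
  injective (decode E lt h).
Proof.
move=> KT h_lt hN.
suff H a b : lt a b -> decode E lt h a <> decode E lt h b.
  by move=> a b e; case: (lt_total KT a b) => // /H; rewrite e.
rewrite (ltE KT) => ab; rewrite !ffunE => -[_ /(congr1 val)] /=.
have := (rank_bound KT a, rank_bound KT b) => -[ra rb].
rewrite !inordK ?ltnS 1?ltnW ?hN //; try lia.
by have := h_lt (rank lt a).*2.+1 (rank lt b).*2.+1; lia.
Qed.

End Grid.

(** * The Ramsey property, from Ramsey's theorem and the partite construction *)

Theorem theorem8p4 :
  forall (k : nat), 0 < k ->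
  forall (TA : finType) (EA ltA : rel TA) (TB : finType) (EB ltB : rel TB),
    inK EA ltA -> inK EB ltB ->
    exists (TC : finType) (EC ltC : rel TC),
      inK EC ltC /\ arrows k EA ltA EB ltB EC ltC.
Proof.
move=> k k_gt0 TA EA ltA TB EB ltB KA KB.
pose i0 := Ordinal k_gt0.
have [N HN] := ramsey i0 #|TA|.*2 #|TB|.*2.
pose D : finType := ('I_N.+1 * 'I_N.+1)%type.
(* A disjoint union of copies of B, one over each map [TB -> D]: the placement [beta] is known only
   after the colouring. *)
pose P := @System D ({ffun TB -> D} * TB)%type (fun x => x.1 x.2) (fun x y => EB x.2 y.2).
have [Q HQ] := partite_construction (@grid_adj N) EA (enum {ffun TA -> D}) P 'I_k.
exists Q, (@sys_edge N Q), (@sys_lt N Q); split; first exact: sys_inK.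
move=> c; have [Phi [[pPhi ePhi] HPhi]] := HQ c.
pose over alpha s := @section_over D (@grid_adj N) TA EA P alpha s.
(* By homogeneity this is the colour of every section over [alpha]; [i0] is the value when there is
   none. *)
pose color alpha : 'I_k :=
  if [pick s | over alpha s] is Some s then c [set Phi (s a) | a in TA] else i0.
have colorE alpha s : over alpha s -> c [set Phi (s a) | a in TA] = color alpha.
  rewrite /color; case: pickP => [s' os' os|/(_ s)->] //.
  by apply: HPhi os os'; rewrite mem_enum.
(* A sequence of codes gets the colour of the map [TA -> D] that it decodes to. *)
have [h [h_lt hN [i Hi]]] :=
  HN (fun t => color (decode N EA ltA (nth 0 t))).
pose beta := decode N EB ltB h.
pose psi b := Phi (beta, b).
have psi_proj b : proj (psi b) = beta b by rewrite pPhi.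
have psi_edge a b : grid_adj (proj (psi a)) (proj (psi b)) -> edge (psi a) (psi b) = EB a b.
  by rewrite !pPhi => /(ePhi (beta, a) (beta, b)).
have psi_emb := decode_embedding KB h_lt hN psi_proj psi_edge.
exists (psi @: [set: TB]); split; first by exists psi.
exists i => S [f [f_emb ->]] sub.
have /fin_all_exists[g fE] a : exists b, f a = psi b.
  have /(subsetP sub)/imsetP[b _ ->] : f a \in f @: [set: TA] by rewrite imset_f.
  by exists b.
have g_emb : embedding EA ltA EB ltB g.
  case: f_emb psi_emb => [f1 [f2 f3]] [p1 [p2 p3]].
  split; [|split] => [a b e|a b|a b]; first by apply: f1; rewrite !fE e.
    by rewrite -p2 -!fE f2.
  by rewrite -p3 -!fE f3.
have [phi [phi_lt phi_b phi1 phi2]] := slots KA KB g_emb.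
(* The codes selected by [phi] decode to the projection of the copy of A, whose colour is therefore
   [i]. *)
have <- := Hi phi phi_lt phi_b.
set alpha := decode _ _ _ _.
have alphaE a : alpha a = beta (g a).
  move: (rank_bound KA a) (part_rank_le EA ltA a) => ra pa.
  rewrite !ffunE !nth_mkseq /= ?phi1 ?phi2 //.
    by rewrite ltn_Sdouble.
  by rewrite ltn_double; apply: leq_ltn_trans pa ra.
pose s := [ffun a => (beta, g a)] : {ffun TA -> P}.
have -> : f @: [set: TA] = [set Phi (s a) | a in TA].
  by apply/setP => x; apply/imsetP/imsetP => -[a _ ->]; exists a; rewrite // ffunE fE.
apply: colorE; apply/section_overP; split.
- move=> a b; rewrite !alphaE => /(decode_inj KB h_lt hN); exact: g_emb.1.
- by move=> a; rewrite ffunE alphaE.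
- by move=> a b _; rewrite !ffunE /=; case: g_emb => _ [].
Qed.
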